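(* Let $\ell$ be a line of $\mathrm{PG}(8,q)$ fixed by $\sigma$. Then $\ell$ is one of the following three types: (a) $\ell$ is fixed pointwise; then $\ell$ meets $q+1$ $\mathbb S_{\mathrm I}$-planes and is contained in a ptwise-fixed plane (a ptwise-fixed line); (b) $\ell$ contains $\mathrm n+1$ fixed points and $q-\mathrm n$ I$_{\vdots}$-points, and $\ell$ is contained in an $\mathbb S_{\mathrm I}$-plane (a fixed-I-line); (c) $\ell$ contains $\mathrm n+1$ fixed points and $q-\mathrm n$ II$_{\vdots}$-points, $\ell$ meets $\mathrm n+1$ $\mathbb S_{\mathrm I}$-planes and $q-\mathrm n$ $\mathbb S_{\mathrm{II}}$-planes, and $\ell$ is contained in a unique $\mathbb H$-5-space, which is an $\mathbb H_{\mathrm I}$-5-space (a fixed-II-line).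
   Context: Let $q>2$ be a prime power, $\mathrm n\in\{-1,0,1\}$ with $q\equiv\mathrm n\pmod 3$. Let $\phi$ be a collineation of $\mathrm{PG}(2,q^3)$ of order 3 fixing pointwise an $\mathbb F_q$-subplane $\mathcal P_{2,q}$. A point $\bar P$ of $\mathrm{PG}(2,q^3)$ has Type I if in $\mathcal P_{2,q}$, Type II if $\bar P,\bar P^\phi,\bar P^{\phi^2}$ are distinct and collinear, Type III if non-collinear; a line has Type I, II, III if it meets $\mathcal P_{2,q}$ in $q+1$, one, zero points. Bose representation: identifying $\mathbb F_{q^3}^3$ with $\mathbb F_q^9$, each point $\bar P$ corresponds to a plane $[\![P]\!]$ of $\mathrm{PG}(8,q)$ (an $\mathbb S$-plane), each line $\bar\ell$ to the 5-space $[\![\ell]\!]$ spanned by the $\mathbb S$-planes of its points (an $\mathbb H$-5-space); these inherit the types ($\mathbb S_X$-planes, $\mathbb H_X$-5-spaces). $\phi$ induces a projectivity $\sigma$ of $\mathrm{PG}(8,q)$ of order 3 with $[\![P]\!]^\sigma=[\![P^\phi]\!]$. A point is an X-point if its $\mathbb S$-plane is an $\mathbb S_X$-plane. A fixed point is a point fixed by $\sigma$; a I-point $A$ is a I$_{\vdots}$-point if $A,A^\sigma,A^{\sigma^2}$ are distinct and collinear; a II-point $B$ is a II$_{\vdots}$-point if $B,B^\sigma,B^{\sigma^2}$ are collinear. A ptwise-fixed plane is a plane fixed pointwise by $\sigma$. *)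

(* Defs.v *)
From HB Require Import structures.
From mathcomp Require Import all_boot all_order all_algebra all_fingroup all_field.

Set Implicit Arguments.
Unset Strict Implicit.
Unset Printing Implicit Defensive.

Import GRing.Theory.
Local Open Scope ring_scope.

(* Subspaces are linear: a projective subspace of projective dimension d is a *)
(* vector subspace of dimension d + 1.                                        *)
Definition pgpoint (K : fieldType) (V : vectType K) :=
  {P : {vspace V} | \dim P == 1%N}.

Definition pgpoint_vspace (K : fieldType) (V : vectType K) (P : pgpoint V) :
  {vspace V} := sval P.
Coercion pgpoint_vspace : pgpoint >-> space.

Definition pgline (K : fieldType) (V : vectType K) (l : {vspace V}) :=
  \dim l = 2%N.

Definition pgplane (K : fieldType) (V : vectType K) (U : {vspace V}) :=
  \dim U = 3%N.

Definition collinear3 (K : fieldType) (V : vectType K) (A B C : pgpoint V) :=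
  exists l : {vspace V},
    [/\ pgline l, (A <= l)%VS, (B <= l)%VS & (C <= l)%VS].

Definition distinct3 (T : Type) (a b c : T) := [/\ a <> b, a <> c & b <> c].

(* Exactly k objects satisfy Q; k is an integer so that it can be n + 1 or    *)
(* q - n with n possibly equal to -1.                                         *)
Definition has_card (T : eqType) (Q : T -> Prop) (k : int) :=
  exists s : seq T,
    [/\ uniq s, forall x, x \in s <-> Q x & (size s)%:Z = k].

Definition has_order (T : Type) (k : nat) (f : T -> T) :=
  [/\ (0 < k)%N, forall x, iter k f x = x
    & forall j, (0 < j < k)%N -> ~ (forall x, iter j f x = x)].

Definition collineation (K : fieldType) (V : vectType K)
    (f : pgpoint V -> pgpoint V) :=
  bijective f /\
  forall l : {vspace V}, pgline l ->
    exists2 m : {vspace V}, pgline m &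
      forall P : pgpoint V, (P <= l)%VS <-> (f P <= m)%VS.

Definition projectivity (K : fieldType) (V : vectType K)
    (f : pgpoint V -> pgpoint V) :=
  exists2 g : 'End(V), lker g = 0%VS &
    forall P : pgpoint V, (f P : {vspace V}) = (g @: P)%VS.

(* The transformation f of the points maps the point set of U onto that of U'. *)
Definition maps_onto (K : fieldType) (V : vectType K)
    (f : pgpoint V -> pgpoint V) (U U' : {vspace V}) :=
  forall Y : pgpoint V,
    (Y <= U')%VS <-> exists2 X : pgpoint V, (X <= U)%VS & f X = Y.

Definition ptwise_fixed (K : fieldType) (V : vectType K)
    (f : pgpoint V -> pgpoint V) (U : {vspace V}) :=
  forall X : pgpoint V, (X <= U)%VS -> f X = X.

(* The points whose coordinates with respect to some basis of L^3 (the rows   *)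
(* of M) can be taken in F.                                                   *)
Definition subplane (F : fieldType) (L : fieldExtType F)
    (B : pgpoint 'rV[L]_3 -> Prop) :=
  exists2 M : 'M[L]_3, M \in unitmx &
    forall P : pgpoint 'rV[L]_3,
      B P <-> exists2 a : 'rV[F]_3, a != 0 &
                (P : {vspace 'rV[L]_3}) = <[map_mx (in_alg L) a *m M]>%VS.

(* An identification of F^9 with L^3, as vector spaces over F. *)
Definition identification (F : fieldType) (L : fieldExtType F)
    (iota : 'rV[F]_9 -> 'rV[L]_3) :=
  bijective iota /\
  forall (a : F) (u v : 'rV[F]_9),
    iota (a *: u + v) = a%:A *: iota u + iota v.

Section Bose.

Variables (F : finFieldType) (L : fieldExtType F).
Variable iota : 'rV[F]_9 -> 'rV[L]_3.
Variable B : pgpoint 'rV[L]_3 -> Prop.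
Variable phi : pgpoint 'rV[L]_3 -> pgpoint 'rV[L]_3.
Variable sigma : pgpoint 'rV[F]_9 -> pgpoint 'rV[F]_9.

Definition typeI_point (P : pgpoint 'rV[L]_3) := B P.

Definition typeII_point (P : pgpoint 'rV[L]_3) :=
  distinct3 P (phi P) (phi (phi P)) /\ collinear3 P (phi P) (phi (phi P)).

Definition typeI_line (l : {vspace 'rV[L]_3}) :=
  pgline l /\
  has_card (fun P : pgpoint 'rV[L]_3 => (P <= l)%VS /\ B P) (#|F|%:Z + 1).

Definition Splane (P : {vspace 'rV[L]_3}) : {vspace 'rV[F]_9} :=
  <<[seq w <- enum {: 'rV[F]_9} | iota w \in P]>>%VS.

(* As iota is onto, <[iota w]> runs over the points of l (and the zero        *)
(* subspace, which contributes nothing): this is the span of their Splanes.   *)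
Definition H5space (l : {vspace 'rV[L]_3}) : {vspace 'rV[F]_9} :=
  (\sum_(w : 'rV[F]_9 | iota w \in l) Splane <[iota w]>)%VS.

Definition SI_plane (U : {vspace 'rV[F]_9}) :=
  exists2 P : pgpoint 'rV[L]_3, typeI_point P & U = Splane P.

Definition SII_plane (U : {vspace 'rV[F]_9}) :=
  exists2 P : pgpoint 'rV[L]_3, typeII_point P & U = Splane P.

Definition is_H5space (H : {vspace 'rV[F]_9}) :=
  exists2 l : {vspace 'rV[L]_3}, pgline l & H = H5space l.

Definition is_HI_5space (H : {vspace 'rV[F]_9}) :=
  exists2 l : {vspace 'rV[L]_3}, typeI_line l & H = H5space l.

Definition meets (U W : {vspace 'rV[F]_9}) :=
  exists X : pgpoint 'rV[F]_9, (X <= U)%VS /\ (X <= W)%VS.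

Definition I_point (X : pgpoint 'rV[F]_9) :=
  exists2 U : {vspace 'rV[F]_9}, SI_plane U & (X <= U)%VS.

Definition II_point (X : pgpoint 'rV[F]_9) :=
  exists2 U : {vspace 'rV[F]_9}, SII_plane U & (X <= U)%VS.

Definition Idots_point (X : pgpoint 'rV[F]_9) :=
  [/\ I_point X, distinct3 X (sigma X) (sigma (sigma X))
    & collinear3 X (sigma X) (sigma (sigma X))].

Definition IIdots_point (X : pgpoint 'rV[F]_9) :=
  II_point X /\ collinear3 X (sigma X) (sigma (sigma X)).

Definition points_on (Q : pgpoint 'rV[F]_9 -> Prop) (l : {vspace 'rV[F]_9})
    (k : int) :=
  has_card (fun X : pgpoint 'rV[F]_9 => (X <= l)%VS /\ Q X) k.

Definition meets_exactly (l : {vspace 'rV[F]_9})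
    (Q : {vspace 'rV[F]_9} -> Prop) (k : int) :=
  has_card (fun U : {vspace 'rV[F]_9} => Q U /\ meets l U) k.

Definition fixed_point (X : pgpoint 'rV[F]_9) := sigma X = X.

Definition ptwise_fixed_line (l : {vspace 'rV[F]_9}) :=
  [/\ ptwise_fixed sigma l,
      meets_exactly l SI_plane (#|F|%:Z + 1)
    & exists2 U : {vspace 'rV[F]_9},
        pgplane U /\ ptwise_fixed sigma U & (l <= U)%VS].

Definition fixed_I_line (n : int) (l : {vspace 'rV[F]_9}) :=
  [/\ points_on fixed_point l (n + 1),
      points_on Idots_point l (#|F|%:Z - n)
    & exists2 U : {vspace 'rV[F]_9}, SI_plane U & (l <= U)%VS].

Definition fixed_II_line (n : int) (l : {vspace 'rV[F]_9}) :=
  [/\ points_on fixed_point l (n + 1),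
      points_on IIdots_point l (#|F|%:Z - n),
      meets_exactly l SI_plane (n + 1),
      meets_exactly l SII_plane (#|F|%:Z - n)
    & exists H : {vspace 'rV[F]_9},
        [/\ is_HI_5space H, (l <= H)%VS
          & forall H' : {vspace 'rV[F]_9},
              is_H5space H' -> (l <= H')%VS -> H' = H]].

End Bose.

(* Main.v *)
Require Import Defs.
From mathcomp Require Import all_boot all_order all_algebra all_fingroup all_field.
From mathcomp Require Import ring zify.

(* Carried to L^3 (L = F_{q^3}) by the identification, a linear map T inducing
   sigma sends spread elements to spread elements; in the coordinates of the
   subplane it reads v |-> c v^tau, where tau generates Gal(L / F), and its cube
   is the scalar N = N_{L/F}(c) of F.  The constant c need not be 1, but an
   invariant line forces N = d^3 with d in F, and then S = T / d is semilinear
   with S^3 = 1.  By Dedekind independence of 1, tau, tau^2, every S-invariant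
   L-subspace is spanned by S-fixed vectors; in particular the points of type I
   are exactly the fixed points of phi, and an invariant L-line has type I.

   On an invariant line l of PG(8, q), sigma-orbits have length 1 or 3 and three
   fixed points make sigma trivial on l, so l is fixed pointwise (a) or has
   exactly n + 1 fixed points; then (b) and (c) separate according to whether the
   L-span of l is a point or a line of PG(2, q^3). *)

Set Implicit Arguments.
Unset Strict Implicit.
Unset Printing Implicit Defensive.

Import GRing.Theory.
Local Open Scope ring_scope.

(** * Cardinalities *)

Lemma eq_has_card (T : eqType) (Q Q' : T -> Prop) (k : int) :
  (forall x, Q x <-> Q' x) -> has_card Q k -> has_card Q' k.
Proof. by move=> QQ' [s [Us sQ ks]]; exists s; split=> // x; rewrite sQ. Qed.

Lemma has_card_image (T U : eqType) (Q : T -> Prop) (f : T -> U) (k : int) :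
    (forall x y, Q x -> Q y -> f x = f y -> x = y) ->
  has_card Q k -> has_card (fun y => exists2 x, Q x & f x = y) k.
Proof.
move=> injf [s [Us sQ <-]]; exists (map f s); split; last by rewrite size_map.
  by rewrite map_inj_in_uniq // => x y /sQ Qx /sQ Qy; apply: injf.
move=> y; split=> [/mapP[x /sQ Qx ->]|[x /sQ sx <-]]; first by exists x.
exact: map_f.
Qed.

(** By induction on the size: the orbit of the head consists of three distinct elements of [s], and
    removing it leaves a list still closed under [f]. *)
Lemma fixfree_order3_size (T : eqType) (f : T -> T) (s : seq T) :
    (forall x, f (f (f x)) = x) -> uniq s ->
    {in s, forall x, f x \in s /\ f x <> x} ->
  (3 %| size s)%N.
Proof.
move=> f3; have [m] := ubnP (size s); elim: m s => // m IHm [//|x s'] lt_s Us fs.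
set s := x :: s' in lt_s Us fs *.
pose o := [:: x; f x; f (f x)].
have sx : x \in s by rewrite mem_head.
have [sfx nfx] := fs _ sx; have [sffx nffx] := fs _ sfx.
have injf : injective f by apply: (can_inj (g := f \o f)); apply: f3.
have Uo : uniq o.
  rewrite /o /= !inE negb_or !andbT; apply/andP; split; last first.
    by apply/eqP=> /esym.
  apply/andP; split; apply/eqP; first by move/esym.
  by move=> e; apply: nfx; rewrite {1}e f3.
have so : {subset o <= s} by move=> y; rewrite !inE => /or3P[]/eqP->.
have size_o : size (filter [in o] s) = 3.
  rewrite -(perm_size (s1 := o)) //; apply: uniq_perm; rewrite ?filter_uniq //.
  by move=> y; rewrite mem_filter; case oy: (y \in o) => //=; rewrite so.
rewrite -(count_predC [in o] s) -!size_filter size_o dvdn_addr //.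
apply: IHm.
  rewrite size_filter; move: (count_predC [in o] s) lt_s.
  by rewrite -size_filter size_o => <-; lia.
  by rewrite filter_uniq.
move=> y; rewrite mem_filter => /andP[oy /fs[sfy nfy]]; split=> //.
rewrite (mem_filter (predC [in o])) sfy andbT; apply: contra oy; rewrite !inE.
case/or3P=> /eqP e; apply/or3P.
- by apply: Or33; rewrite -e f3.
- by apply: Or31; apply/eqP/injf.
- by apply: Or32; apply/eqP/injf.
Qed.

(** * Points and lines *)

Section Points.

Variables (K : fieldType) (V : vectType K).
Implicit Types (u v w : V) (P Q : pgpoint V) (l U : {vspace V}).

Definition pgpt v (nz : v != 0) : pgpoint V :=
  exist _ <[v]>%VS (introT eqP (etrans (dim_vline v) (congr1 nat_of_bool nz))).

Lemma pgpoint_inj P Q : (P : {vspace V}) = Q -> P = Q.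
Proof. exact: val_inj. Qed.

Lemma pgpointP P : exists v (nz : v != 0), P = pgpt nz.
Proof.
have dP : \dim P = 1 by apply/eqP; apply: (valP P).
have nz : vpick P != 0 by rewrite vpick0 -dimv_eq0 dP.
exists (vpick P), nz; apply/pgpoint_inj/esym/eqP.
by rewrite eqEdim -memvE memv_pick dP dim_vline nz.
Qed.

Lemma pgpt_eq v w (nzv : v != 0) (nzw : w != 0) :
  w \in <[v]>%VS -> pgpt nzw = pgpt nzv.
Proof.
move=> vw; apply/pgpoint_inj/eqP.
by rewrite eqEdim -memvE vw !dim_vline nzv nzw.
Qed.

Lemma pgpt_mem v (nz : v != 0) P : v \in (P : {vspace V}) -> P = pgpt nz.
Proof. by have [w [nzw ->]] := pgpointP P => vw; rewrite (pgpt_eq nzw nz). Qed.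

Lemma vline_sym u v : u != 0 -> u \in <[v]>%VS -> v \in <[u]>%VS.
Proof.
move=> nzu /vlineP[a eu]; apply/vlineP; exists a^-1; rewrite eu scalerK //.
by apply: contraNneq nzu => a0; rewrite eu a0 scale0r.
Qed.

Lemma dim_addv_line u v :
  u != 0 -> v \notin <[u]>%VS -> \dim (<[u]> + <[v]>) = 2.
Proof.
move=> nzu uv.
have nzv : v != 0 by apply: contraNneq uv => ->; rewrite mem0v.
rewrite dimv_disjoint_sum ?dim_vline ?nzu ?nzv //.
apply/eqP; rewrite -subv0; apply/subvP=> w; rewrite memv_cap memv0.
case/andP=> uw vw; apply: contraNT uv => nzw.
by case/vlineP: uw (vline_sym nzw vw) => a -> /vlineP[b ->]; rewrite !memvZ ?memv_line.
Qed.

Lemma pgline_gen l u v : pgline l -> u \in l -> v \in l ->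
  u != 0 -> v \notin <[u]>%VS -> l = (<[u]> + <[v]>)%VS.
Proof.
move=> dl lu lv nzu uv; apply/esym/eqP.
by rewrite eqEdim dim_addv_line // dl subv_add -!memvE lu lv.
Qed.

Lemma line_vecP u v w :
  reflect (exists a b, w = a *: u + b *: v) (w \in (<[u]> + <[v]>)%VS).
Proof.
apply: (iffP memv_addP) => [[_ /vlineP[a ->] [_ /vlineP[b ->] ->]]|[a [b ->]]].
  by exists a, b.
by exists (a *: u); rewrite ?memvZ ?memv_line //; exists (b *: v); rewrite ?memvZ ?memv_line.
Qed.

Lemma line_free u v a b : u != 0 -> v \notin <[u]>%VS ->
  a *: u + b *: v = 0 -> a = 0 /\ b = 0.
Proof.
move=> nzu uv e.
have b0 : b = 0.
  apply: contraNeq uv => nzb; apply/vlineP; exists (- (b^-1 * a)).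
  rewrite scaleNr -scalerA -scalerN -[LHS](scalerK nzb); congr (_ *: _).
  by apply/eqP; rewrite -subr_eq0 opprK addrC e.
move: e; rewrite b0 scale0r addr0 => /eqP; rewrite scaler_eq0 (negPf nzu) orbF.
by move/eqP.
Qed.

Lemma pgline_ex l : pgline l ->
  exists u v, [/\ u \in l, v \in l, u != 0 & v \notin <[u]>%VS].
Proof.
move=> dl; have nzu : vpick l != 0 by rewrite vpick0 -dimv_eq0 dl.
have: ~~ (l <= <[vpick l]>)%VS.
  by apply/negP=> /dimvS; rewrite dl dim_vline nzu.
case/subvPn=> v lv uv.
by exists (vpick l), v; split; rewrite ?memv_pick.
Qed.

Lemma line_point P l : (P <= l)%VS -> exists v (nz : v != 0), P = pgpt nz /\ v \in l.
Proof. by have [v [nz ->]] := pgpointP P => Pl; exists v, nz. Qed.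

(* Three fixed points of a projective line form a frame of it. *)
Lemma three_eigen_scalar (g : 'End(V)) l P1 P2 P3 :
    pgline l -> distinct3 P1 P2 P3 ->
    [/\ P1 <= l, P2 <= l & P3 <= l]%VS ->
    [/\ g @: P1 <= P1, g @: P2 <= P2 & g @: P3 <= P3]%VS ->
  exists c, forall w, w \in l -> g w = c *: w.
Proof.
move=> dl [n12 n13 n23] [P1l P2l P3l] [gP1 gP2 gP3].
have eig P : (P <= l)%VS -> (g @: P <= P)%VS ->
    exists v (nz : v != 0) c, [/\ P = pgpt nz, v \in l & g v = c *: v].
  case/line_point=> v [nz [-> lv]] /= gv; exists v, nz.
  have /vlineP[c ec] : g v \in <[v]>%VS.
    exact/(subvP gv)/memv_img/memv_line.
  by exists c.
have [u [nzu [cu [eu lu gu]]]] := eig P1 P1l gP1.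
have [v [nzv [cv [ev lv gv]]]] := eig P2 P2l gP2.
have [w [nzw [cw [ew lw gw]]]] := eig P3 P3l gP3.
subst P1 P2 P3.
have uv : v \notin <[u]>%VS by apply/negP=> /(pgpt_eq nzu nzv)/esym.
have uw : w \notin <[u]>%VS by apply/negP=> /(pgpt_eq nzu nzw)/esym.
have vw : w \notin <[v]>%VS by apply/negP=> /(pgpt_eq nzv nzw)/esym.
(* No two of the three points coincide, so both coordinates of [w] are nonzero; comparing [g w] with
   [cw *: w] then gives [cu = cw = cv]. *)
move: lw; rewrite (pgline_gen dl lu lv nzu uv) => /line_vecP[a [b we]].
have nza : a != 0.
  by apply: contraNneq vw => a0; rewrite we a0 scale0r add0r memvZ ?memv_line.
have nzb : b != 0.
  by apply: contraNneq uw => b0; rewrite we b0 scale0r addr0 memvZ ?memv_line.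
have [] : (a * (cu - cw)) = 0 /\ (b * (cv - cw)) = 0.
  apply: (line_free nzu uv); move: gw; rewrite we linearD !linearZ /= gu gv.
  rewrite scalerDr !scalerA => /eqP; rewrite -subr_eq0 => /eqP <-.
  by rewrite !mulrBr !scalerBl opprD addrACA (mulrC a cw) (mulrC b cw).
move=> /eqP; rewrite mulf_eq0 (negPf nza) subr_eq0 => /eqP ecu.
move=> /eqP; rewrite mulf_eq0 (negPf nzb) subr_eq0 => /eqP ecv.
exists cw => x /line_vecP[r [s ->]].
by rewrite linearD !linearZ /= gu gv ecu ecv scalerDr !scalerA !(mulrC cw).
Qed.

End Points.

Lemma pgline_card (F : finFieldType) (V : vectType F) (l : {vspace V}) :
  pgline l -> has_card (fun X : pgpoint V => (X <= l)%VS) (#|F|%:Z + 1).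
Proof.
move=> dl; have [u [v [lu lv nzu uv]]] := pgline_ex dl.
have el := pgline_gen dl lu lv nzu uv.
have nzw a : v + a *: u != 0.
  apply: contraNneq uv => /eqP; rewrite addr_eq0 => /eqP->.
  by rewrite memvN memvZ ?memv_line.
(* The point of [u], then one point of [v + a *: u] for each [a] in [F]. *)
exists (pgpt nzu :: [seq pgpt (nzw a) | a <- enum F]); split.
- rewrite /= map_inj_uniq ?enum_uniq ?andbT.
    apply/mapP=> -[a _ /(congr1 (@pgpoint_vspace _ _)) /= e].
    have : v + a *: u \in <[u]>%VS by rewrite e memv_line.
    by rewrite rpredDr ?(negPf uv) // memvZ ?memv_line.
  move=> a b /(congr1 (@pgpoint_vspace _ _)) /= e.
  have /vlineP[c ec] : v + a *: u \in <[v + b *: u]>%VS by rewrite -e memv_line.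
  have [] : (a - c * b) = 0 /\ (1 - c) = 0.
    apply: (line_free nzu uv); apply/eqP; rewrite !scalerBl scale1r addrACA -opprD.
    by rewrite subr_eq0 addrC ec scalerDr scalerA addrC.
  move=> /eqP; rewrite subr_eq0 => /eqP-> /eqP; rewrite subr_eq0 => /eqP<-.
  by rewrite mul1r.
- move=> X; split.
    rewrite inE => /orP[/eqP->|/mapP[a _ ->]]; first by [].
    by rewrite /= -memvE rpredD ?memvZ.
  case/line_point=> w [nz [-> lw]]; move: (lw); rewrite el => /line_vecP[a [b we]].
  rewrite inE; have [b0|nzb] := eqVneq b 0.
    rewrite (pgpt_eq nzu nz) ?eqxx // we b0 scale0r addr0 memvZ ?memv_line //.
  apply/orP; right; apply/mapP; exists (b^-1 * a); first by rewrite mem_enum.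
  apply: pgpt_eq; apply/vlineP; exists b.
  by rewrite we scalerDr scalerA mulrA divff // mul1r addrC.
- by rewrite /= size_map -cardE -addn1 PoszD.
Qed.

(* Nontrivial orbits on the line have length three, so modulo 3 there are q + 1,
   hence n + 1, fixed points, and there are at most two unless all are fixed. *)
Lemma fixed_line_count (F : finFieldType) (V : vectType F) (n : int)
    (sigma : pgpoint V -> pgpoint V) (g : 'End(V)) (l : {vspace V}) :
    n \in [:: -1; 0; 1] -> (#|F|%:Z = n %[mod 3])%Z ->
    (forall X : pgpoint V, (sigma X : {vspace V}) = (g @: X)%VS) ->
    (forall X, sigma (sigma (sigma X)) = X) ->
    pgline l -> (forall X : pgpoint V, (X <= l)%VS -> (sigma X <= l)%VS) ->
  (exists c, forall w, w \in l -> g w = c *: w) \/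
  has_card (fun X : pgpoint V => (X <= l)%VS /\ sigma X = X) (n + 1) /\
  has_card (fun X : pgpoint V => (X <= l)%VS /\ sigma X <> X) (#|F|%:Z - n).
Proof.
move=> hn hnq gE s3 dl ls; have [s [Us sP szs]] := pgline_card dl.
pose fixs := [seq X <- s | sigma X == X].
pose movs := [seq X <- s | sigma X != X].
have fixsP (X : pgpoint V) : X \in fixs <-> (X <= l)%VS /\ sigma X = X.
  rewrite mem_filter; split=> [/andP[/eqP-> /sP] //|[/sP-> ->]].
  by rewrite eqxx.
have movsP (X : pgpoint V) : X \in movs <-> (X <= l)%VS /\ sigma X <> X.
  rewrite mem_filter; split=> [/andP[/eqP ? /sP] //|[/sP-> /eqP->]] //.
have m3 : (3 %| size movs)%N.
  apply: (fixfree_order3_size s3); rewrite ?filter_uniq // => X /movsP[Xl nX].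
  split=> //; apply/movsP; split; first exact: ls.
  by move=> e; apply: nX; rewrite -[RHS]s3 e e.
have szfm : (size fixs + size movs = size s)%N.
  by rewrite !size_filter count_predC.
have [lt3|ge3] := ltnP (size fixs) 3.
  (* Both [size fixs] and [n + 1] lie in {0, 1, 2}, and they agree modulo 3. *)
  right; have szf : (size fixs)%:Z = n + 1.
    move: hn hnq; rewrite !inE; move: m3 szfm szs lt3; clear; lia.
  split; [exists fixs | exists movs]; split; rewrite ?filter_uniq //.
  by rewrite -(addrK 1 #|F|%:Z) -szs -szfm PoszD szf (addrAC n) addrK (addrC n) addrK.
left; case efix: fixs ge3 (filter_uniq (fun X => sigma X == X) Us) => [|X1 [|X2 [|X3 r]]] //= _.
rewrite -/fixs efix /= !inE !negb_or => /and3P[/and3P[/eqP n12 /eqP n13 _] /andP[/eqP n23 _] _].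
have fixX (X : pgpoint V) : X \in [:: X1, X2, X3 & r] -> (X <= l)%VS /\ (g @: X <= X)%VS.
  by rewrite -efix => /fixsP[Xl fX]; rewrite -gE fX subvv.
have [l1 f1] : _ /\ _ := fixX X1 (mem_head _ _).
have [l2 f2] : (X2 <= l)%VS /\ (g @: X2 <= X2)%VS.
  by apply: fixX; rewrite !inE eqxx orbT.
have [l3 f3] : (X3 <= l)%VS /\ (g @: X3 <= X3)%VS.
  by apply: fixX; rewrite !inE eqxx !orbT.
exact: (three_eigen_scalar (P1 := X1) (P2 := X2) (P3 := X3) dl).
Qed.
(** * Descent along a semilinear map of order three *)

Section Descent.

Variables (L : fieldType) (V : vectType L) (tau : L -> L) (S : V -> V) (z : L).
Hypothesis tau1 : tau 1 = 1.
Hypothesis tauM : forall x y, tau (x * y) = tau x * tau y.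
Hypothesis tau3 : forall x, tau (tau (tau x)) = x.
Hypothesis tau_nt : tau z != z.
Hypothesis SD : forall u v, S (u + v) = S u + S v.
Hypothesis SZ : forall x v, S (x *: v) = tau x *: S v.
Hypothesis S3 : forall v, S (S (S v)) = v.

(* Dedekind independence of 1, tau, tau^2, with coefficients in V / D. *)
Lemma trace_notin (D : {vspace V}) (v0 v1 v2 : V) : v0 \notin D ->
  exists y, y *: v0 + tau y *: v1 + tau (tau y) *: v2 \notin D.
Proof.
pose H y := y *: v0 + tau y *: v1 + tau (tau y) *: v2.
move=> Dv0; have [H1|] := boolP (H 1 \in D); last by exists 1.
have [Hz|] := boolP (H z \in D); last by exists z.
have [Hzz|] := boolP (H (z * z) \in D); last by exists (z * z).
case/negP: Dv0.
have n1 : z - tau z != 0 by rewrite subr_eq0 eq_sym.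
have n2 : z - tau (tau z) != 0.
  by rewrite subr_eq0; apply: contraNneq tau_nt => e; rewrite {1}e tau3.
have HD x1 x2 x3 : x1 *: H (z * z) + x2 *: H z + x3 *: H 1 =
    (x1 * (z * z) + x2 * z + x3) *: v0 +
    (x1 * (tau z * tau z) + x2 * tau z + x3) *: v1 +
    (x1 * (tau (tau z) * tau (tau z)) + x2 * tau (tau z) + x3) *: v2.
  rewrite /H !tauM !tau1 !scale1r !(scalerDr, scalerDl, scalerA).
  by rewrite [LHS](AC (3*3*3) ((1*4*7)*(2*5*8)*(3*6*9))).
(* The coefficients are those of (X - tau z)(X - tau^2 z), so the combination kills [v1] and [v2]
   and leaves a nonzero multiple of [v0]. *)
have : 1 *: H (z * z) + (- (tau z + tau (tau z))) *: H z
    + (tau z * tau (tau z)) *: H 1 \in D.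
  by apply: rpredD; [apply: rpredD|]; apply: rpredZ.
rewrite HD; set k0 := (X in X *: v0); set k1 := (X in X *: v1).
set k2 := (X in X *: v2); have -> : k1 = 0 by rewrite /k1; ring.
have -> : k2 = 0 by rewrite /k2; ring.
have -> : k0 = (z - tau z) * (z - tau (tau z)) by rewrite /k0; ring.
by rewrite !scale0r !addr0 rpredZeq mulf_eq0 (negPf n1) (negPf n2).
Qed.

(** The sum of [y *: v] and its images under [S] and [S^2] is [S]-fixed and stays in [U];
    [trace_notin] chooses [y] so that it avoids [D]. *)
Lemma semilinear_descent (U D : {vspace V}) :
    (forall u, u \in U -> S u \in U) -> ~~ (U <= D)%VS ->
  exists u, [/\ u \in U, u \notin D & S u = u].
Proof.
move=> US /subvPn[v Uv Dv].
have [y Dy] := trace_notin (S v) (S (S v)) Dv.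
exists (y *: v + tau y *: S v + tau (tau y) *: S (S v)); split=> //.
  by rewrite !rpredD ?rpredZ ?US.
by rewrite !SD !SZ S3 tau3 addrC addrA.
Qed.

End Descent.
(** * The semilinear map attached to the collineation *)

Section Coordinates.

Variables (F : fieldType) (L : fieldExtType F).
Variables (T : 'rV[L]_3 -> 'rV[L]_3) (M : 'M[L]_3).
Hypothesis uM : M \in unitmx.
Hypothesis TF : forall a (u v : 'rV[L]_3), T (a%:A *: u + v) = a%:A *: T u + T v.
Hypothesis T_inj : forall v, T v = 0 -> v = 0.
Hypothesis T_line : forall x (v : 'rV[L]_3), T (x *: v) \in <[T v]>%VS.
Hypothesis T_frame : forall a : 'rV[F]_3,
  T (map_mx (in_alg L) a *m M) \in <[map_mx (in_alg L) a *m M]>%VS.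

(** [T] fixes the points of the subplane and maps each 1-dimensional L-subspace into another, so in
    the frame [M] it acts on each coordinate separately. The all-ones vector shows that these
    actions are one map [s], and dividing by [c = s 1] makes it multiplicative. *)
Lemma frame_semilinear : exists (tau : L -> L) (c : L),
  [/\ c != 0, tau 1 = 1, forall x y, tau (x * y) = tau x * tau y,
      forall a (x y : L), tau (a%:A * x + y) = a%:A * tau x + tau y
    & forall v, T (v *m M) = c *: (map_mx tau v *m M)].
Proof.
have TD u v : T (u + v) = T u + T v by have := TF 1 u v; rewrite !scale1r.
have T0 : T 0 = 0 by apply: (addrI (T 0)); rewrite -TD !addr0.
have TS (I : finType) (f : I -> 'rV[L]_3) : T (\sum_i f i) = \sum_i T (f i).
  by apply: (big_morph T TD T0).
have Tpt x (a : 'rV[F]_3) : exists k,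
    T (x *: map_mx (in_alg L) a *m M) = k *: map_mx (in_alg L) a *m M.
  have /vlineP[k1 e1] := T_line x (map_mx (in_alg L) a *m M).
  have /vlineP[k2 e2] := T_frame a.
  by exists (k1 * k2); rewrite -scalemxAl e1 e2 scalerA scalemxAl.
pose e i : 'rV[L]_3 := delta_mx 0 i.
pose t i x : L := (T (x *: e i *m M) *m invmx M) 0 i.
have Te i x : T (x *: e i *m M) = t i x *: e i *m M.
  have [k] := Tpt x (delta_mx 0 i); rewrite map_delta_mx -/(e i) => E.
  by rewrite /t E mulmxK // !mxE !eqxx mulr1.
have Tv v : T (v *m M) = (\row_i t i (v 0 i)) *m M.
  rewrite [in LHS](row_sum_delta v) mulmx_suml TS.
  rewrite [in RHS](row_sum_delta (\row_i _)) mulmx_suml.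
  by apply: eq_bigr => i _; rewrite Te mxE.
have t0 i x : t i x = t 0 x.
  have [k] := Tpt x (const_mx 1); rewrite map_const_mx rmorph1 Tv.
  move/(can_inj (mulmxK uM))/rowP => E.
  by have := E i; have := E 0; rewrite !mxE !mulr1 => -> ->.
have {}Tv v : T (v *m M) = map_mx (t 0) v *m M.
  by rewrite Tv; congr (_ *m _); apply/rowP=> i; rewrite !mxE t0.
pose s : L -> L := t 0.
have sF a x y : s (a%:A * x + y) = a%:A * s x + s y.
  have := TF a (const_mx x *m M) (const_mx y *m M).
  rewrite scalemxAl -mulmxDl !Tv scalemxAl -mulmxDl.
  by move/(can_inj (mulmxK uM))/rowP/(_ 0); rewrite !mxE.
have s1 : s 1 != 0.
  apply/eqP=> s10; have /T_inj : T (const_mx 1 *m M) = 0.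
    by rewrite Tv map_const_mx -/(s 1) s10 [LHS]mul0mx.
  move/(congr1 (mulmx^~ (invmx M))); rewrite mul0mx mulmxK // => /rowP/(_ 0)/eqP.
  by rewrite !mxE oner_eq0.
have sM x y : s (x * y) * s 1 = s x * s y.
  (* The coordinates [y] and [1] of [v] both see the same factor [k] between [T (x *: v)] and [T v];
     eliminating it yields the identity. *)
  pose v : 'rV[L]_3 := \row_i if i == 0 then y else 1.
  have /vlineP[k] := T_line x (v *m M).
  rewrite scalemxAl !Tv scalemxAl => /(can_inj (mulmxK uM))/rowP E.
  have := E 0; have := E 1; rewrite !mxE /= -/s mulr1 => -> ->; ring.
exists (fun x => s x / s 1), (s 1); split=> //.
- exact: divff.
- move=> x y; apply: (mulIf s1); apply: (mulIf s1); rewrite divfK // sM; field; exact: s1.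
- by move=> a x y; rewrite sF mulrDl mulrA.
move=> v; rewrite Tv scalemxAl; congr (_ *m _); apply/rowP=> i; rewrite !mxE.
by rewrite mulrC divfK.
Qed.

End Coordinates.

(** * F-algebra endomorphisms of L and eigenvectors in frame coordinates *)

Section Automorphism.

Variables (F : fieldType) (L : fieldExtType F) (tau : L -> L).
Hypothesis tau1 : tau 1 = 1.
Hypothesis tauM : forall x y, tau (x * y) = tau x * tau y.
Hypothesis tauF : forall a (x y : L), tau (a%:A * x + y) = a%:A * tau x + tau y.

Let tauD x y : tau (x + y) = tau x + tau y.
Proof. by have := tauF 1 x y; rewrite scale1r !mul1r. Qed.

Let tau0 : tau 0 = 0.
Proof. by apply: (addrI (tau 0)); rewrite -tauD !addr0. Qed.

Lemma tau_alg a : tau a%:A = a%:A.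
Proof. by have := tauF a 1 0; rewrite mulr1 tau0 !addr0 tau1 mulr1. Qed.

(* L has no proper intermediate field. *)
Lemma tau_fixed_alg x z : \dim {: L} = 3%N ->
  tau z != z -> tau x = x -> exists a : F, x = a%:A.
Proof.
move=> dL tz tx; suff /vlineP[a ->] : x \in 1%VS by exists a.
apply: contraT => x1.
(* As 3 is prime, F(x) is F or L; in the second case [z] would be a polynomial in [x] over F, hence
   fixed by [tau]. *)
have : (\dim <<1; x>> %| 3)%N by rewrite -dL; apply: field_dimS; apply: subvf.
rewrite dvdn_divisors // !inE => /orP[] /eqP d.
  case/negP: x1; suff -> : 1%VS = <<1; x>>%VS :> {vspace L} by apply: memv_adjoin.
  by apply/eqP; rewrite eqEdim subv_adjoin d dimv1.
have : z \in <<1; x>>%VS.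
  suff -> : <<1; x>>%VS = fullv by rewrite memvf.
  by apply/eqP; rewrite eqEdim subvf d dL.
case/Fadjoin_polyP=> p /polyOverP p1 ez; case/eqP: tz; rewrite ez.
have txi i : tau (x ^+ i) = x ^+ i.
  by elim: i => [|i IHi]; rewrite ?expr0 // exprS tauM tx IHi.
rewrite horner_coef (big_morph tau tauD tau0); apply: eq_bigr => i _.
by rewrite tauM txi; have /vlineP[a ->] := p1 i; rewrite tau_alg.
Qed.

(** For [x] outside F, independence of 1 and [x] over F makes the factors at 1, [x] and [1 + x]
    equal, and the factor at 1 is 1. *)
Lemma tau_scalar_pow3 : (forall x, exists a : F, tau (tau (tau x)) = a *: x) ->
  forall x, tau (tau (tau x)) = x.
Proof.
move=> t3 x; have [/vlineP[a ->]|x1] := boolP (x \in 1%VS).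
  by rewrite !tau_alg.
have [a ea] := t3 x; have [b] := t3 (1 + x); rewrite !tauD !tau1 ea => e.
have [] : 1 - b = 0 /\ a - b = 0.
  apply: (line_free (oner_neq0 L) x1); rewrite !scalerBl scale1r addrACA -opprD.
  by rewrite e scalerDr subrr.
by move=> /subr0_eq <- /subr0_eq ->; rewrite scale1r.
Qed.

(** Being F-linear, [tau] can be tested on a finite basis, which decides between the
    alternatives. *)
Lemma tau_trivial_dec : (exists z, tau z != z) \/ (forall x, tau x = x).
Proof.
have [fixb|/allPn[z _ tz]] := boolP (all (fun z => tau z == z) (vbasis {:L})).
  right=> x; rewrite (coord_vbasis (memvf x)) (big_morph tau tauD tau0).
  apply: eq_bigr => i _; rewrite -mulr_algl tauM tau_alg; congr (_ * _).
  by apply/eqP/(allP fixb)/mem_nth; rewrite size_tuple.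
by left; exists z.
Qed.

Section Frame.

Variables (T : 'rV[L]_3 -> 'rV[L]_3) (M : 'M[L]_3) (c : L).
Hypothesis uM : M \in unitmx.
Hypothesis c_neq0 : c != 0.
Hypothesis TE : forall v, T (v *m M) = c *: (map_mx tau v *m M).

Lemma frame_semilinearZ x v : T (x *: v) = tau x *: T v.
Proof.
rewrite -[v](mulmxKV uM) scalemxAl !TE scalerA mulrC -scalerA; congr (_ *: _).
by rewrite scalemxAl; congr (_ *m _); apply/rowP=> i; rewrite !mxE tauM.
Qed.

(** In coordinates the cube of [T] is [C] times tau^3. Evaluating on the all-ones vector puts [C] in
    F, as [N]; then tau^3 multiplies every element by a factor in F and [tau_scalar_pow3]
    applies. *)
Lemma frame_order3 : (forall v, exists a : F, T (T (T v)) = a%:A *: v) ->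
  (forall x, tau (tau (tau x)) = x) /\
  exists2 N : F, N != 0 & forall v, T (T (T v)) = N%:A *: v.
Proof.
pose C := tau (tau c) * tau c * c; move=> T3.
have tau_neq0 x : x != 0 -> tau x != 0.
  move=> nzx; apply/eqP=> tx0; have := tauM x x^-1.
  by rewrite divff // tau1 tx0 mul0r => /eqP; rewrite oner_eq0.
have nzC : C != 0 by rewrite !mulf_neq0 ?tau_neq0.
have TTT v : T (T (T (v *m M))) = C *: (map_mx (tau \o tau \o tau) v *m M).
  rewrite TE !frame_semilinearZ TE !frame_semilinearZ TE !scalerA.
  by congr (_ *: (_ *m _)); apply/rowP=> i; rewrite !mxE.
have t3 x : exists a : F, C * tau (tau (tau x)) = a%:A * x.
  have [a] := T3 (const_mx x *m M); rewrite TTT !scalemxAl => e; exists a.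
  by move/(can_inj (mulmxK uM))/rowP/(_ 0): e; rewrite !mxE.
have [N eN] := t3 1; rewrite !tau1 !mulr1 in eN.
have nzN : N != 0 by apply: contraNneq nzC; rewrite eN => ->; rewrite scale0r.
have tau3 : forall x, tau (tau (tau x)) = x.
  apply: tau_scalar_pow3 => x; have [a] := t3 x; rewrite eN !mulr_algl => e.
  by exists (N^-1 * a); rewrite -scalerA -e scalerA mulVf // scale1r.
split=> //; exists N => // v; rewrite -[v](mulmxKV uM) TTT eN; congr (_ *: (_ *m _)).
by apply/rowP=> i; rewrite !mxE /= tau3.
Qed.

(* Ratios of coordinates of an eigenvector are fixed by tau. *)
Lemma frame_eigen (d : F) (u : 'rV[L]_3) :
    (forall x, tau x = x -> exists a : F, x = a%:A) -> d != 0 ->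
    u != 0 -> T u = d%:A *: u ->
  exists2 a : 'rV[F]_3, a != 0 & <[u]>%VS = <[map_mx (in_alg L) a *m M]>%VS.
Proof.
move=> tau_fix nzd nzu Tu.
have [v eu] : exists v, u = v *m M by exists (u *m invmx M); rewrite mulmxKV.
have tv i : c * tau (v 0 i) = d%:A * v 0 i.
  move: Tu; rewrite eu TE !scalemxAl => /(can_inj (mulmxK uM))/rowP/(_ i).
  by rewrite !mxE.
have nzdA : d%:A != 0 :> L by rewrite scaler_eq0 oner_eq0 orbF.
have /rV0Pn[k nzk] : v != 0.
  by apply: contraNneq nzu => v0; rewrite eu v0 mul0mx.
have [i|f ef] := @fin_all_exists _ _ (fun i a => v 0 i / v 0 k = a%:A :> L).
  apply: tau_fix; apply: (mulIf nzk); apply: (mulfI nzdA).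
  rewrite divfK // [LHS]mulrCA -!tv -[in RHS](divfK nzk (v 0 i)).
  by rewrite (tauM (_ / _) (v 0 k)) [LHS]mulrCA.
pose a := \row_i f i; exists a.
  apply: contraTneq (oner_neq0 L) => /rowP/(_ k); rewrite !mxE => fk0.
  by rewrite -(divff nzk) ef fk0 scale0r eqxx.
have {}eu : u = v 0 k *: (map_mx (in_alg L) a *m M).
  rewrite {1}eu scalemxAl; congr (_ *m _); apply/rowP=> i.
  by rewrite !mxE in_algE -ef mulrC divfK.
apply/eqP; rewrite eqEsubv -!memvE {1}eu memvZ ?memv_line //=.
by apply: vline_sym => //; rewrite eu memvZ ?memv_line.
Qed.

End Frame.

End Automorphism.
(** * Points of PG(8, q) and the spread *)

Section Spread.

Variables (F : finFieldType) (L : fieldExtType F).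
Variables (iota : 'rV[F]_9 -> 'rV[L]_3) (j : 'rV[L]_3 -> 'rV[F]_9).
Hypothesis iotaK : cancel iota j.
Hypothesis jK : cancel j iota.
Hypothesis iotaF : forall (a : F) (u v : 'rV[F]_9),
  iota (a *: u + v) = a%:A *: iota u + iota v.

Local Notation Splane := (Splane iota).

Lemma iotaD u v : iota (u + v) = iota u + iota v.
Proof. by have := iotaF 1 u v; rewrite !scale1r. Qed.

Lemma iota0 : iota 0 = 0.
Proof. by apply: (addrI (iota 0)); rewrite -iotaD !addr0. Qed.

Lemma iotaZ a u : iota (a *: u) = a%:A *: iota u.
Proof. by have := iotaF a u 0; rewrite iota0 !addr0. Qed.

Lemma iota_eq0 u : (iota u == 0) = (u == 0).
Proof. by rewrite -{1}iota0 (can_eq iotaK). Qed.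

(** The vectors spanning [Splane U] already form an F-subspace because [iota] is linear, so the span
    adds nothing. *)
Lemma mem_Splane (U : {vspace 'rV[L]_3}) w : (w \in Splane U) = (iota w \in U).
Proof.
apply/idP/idP => [|Uw]; last first.
  apply: memv_span; rewrite mem_filter Uw /=.
  by have: w \in enum (fullv : {vspace 'rV[F]_9}) by rewrite mem_enum memvf.
rewrite /Splane; set s := filter _ _ => sw.
rewrite (coord_span (X := in_tuple s) sw) (big_morph iota iotaD iota0).
apply: rpred_sum => i _; rewrite iotaZ rpredZ //.
have : s`_i \in s by rewrite mem_nth.
by rewrite mem_filter => /andP[].
Qed.

(** Every vector of the right side lies in the summand that it indexes. Hence H-5-spaces obey the
    same membership rule [mem_Splane] as spread elements. *)
Lemma H5spaceE m : H5space iota m = Splane m.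
Proof.
apply/eqP; rewrite eqEsubv; apply/andP; split.
  apply/subv_sumP=> w mw; apply/subvP=> x; rewrite !mem_Splane => /vlineP[a ->].
  exact: rpredZ.
apply/subvP=> w; rewrite mem_Splane => mw.
apply: (subvP (sumv_sup w mw (subvv _))).
by rewrite mem_Splane memv_line.
Qed.

Fact iota_vpick_neq0 (X : pgpoint 'rV[F]_9) : iota (vpick X) != 0.
Proof.
by rewrite iota_eq0 vpick0 -dimv_eq0; have /eqP-> : \dim X == 1%N := valP X.
Qed.

(* The point of PG(2, q^3) whose spread element contains X. *)
Definition hull X : pgpoint 'rV[L]_3 := pgpt (iota_vpick_neq0 X).

Lemma hull_pgpt w (nz : w != 0) (nz' : iota w != 0) : hull (pgpt nz) = pgpt nz'.
Proof.
apply: pgpt_eq; have /vlineP[a ->] : vpick (pgpt nz) \in <[w]>%VS by apply: memv_pick.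
by rewrite iotaZ memvZ ?memv_line.
Qed.

Lemma sub_Splane (X : pgpoint 'rV[F]_9) (U : {vspace 'rV[L]_3}) :
  (X <= Splane U)%VS = (hull X <= U)%VS.
Proof.
have [w [nz ->]] := pgpointP X.
have nz' : iota w != 0 by rewrite iota_eq0.
by rewrite (hull_pgpt nz nz') -!memvE mem_Splane.
Qed.

Lemma sub_Splane_hull (X : pgpoint 'rV[F]_9) : (X <= Splane (hull X))%VS.
Proof. by rewrite sub_Splane subvv. Qed.

Lemma hull_unique (X : pgpoint 'rV[F]_9) (P : pgpoint 'rV[L]_3) :
  (X <= Splane P)%VS -> P = hull X.
Proof. by rewrite sub_Splane -memvE => /pgpt_mem; apply. Qed.

Lemma Splane_inj (P Q : pgpoint 'rV[L]_3) : Splane P = Splane Q -> P = Q.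
Proof.
have [v [nz eP]] := pgpointP P => e.
suff : v \in (Q : {vspace _}) by move/pgpt_mem=> ->.
by rewrite -[v]jK -mem_Splane -e mem_Splane jK eP memv_line.
Qed.

(** Two distinct points of [l] span it, so a spread element containing both would contain [l]. *)
Lemma hull_inj_line (l : {vspace 'rV[F]_9}) (X Y : pgpoint 'rV[F]_9) :
    pgline l -> (forall P : pgpoint 'rV[L]_3, ~ (l <= Splane P)%VS) ->
  (X <= l)%VS -> (Y <= l)%VS -> hull X = hull Y -> X = Y.
Proof.
move=> dl nl Xl Yl e; have := sub_Splane_hull X; have := sub_Splane_hull Y.
rewrite {}e; move: (hull Y) => P; case/line_point: Xl => u [nzu [-> lu]].
case/line_point: Yl => v [nzv [-> lv]]; rewrite /= -!memvE => Pv Pu.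
have [uv|uv] := boolP (v \in <[u]>%VS); first exact/esym/pgpt_eq.
by case: (nl P); rewrite (pgline_gen dl lu lv nzu uv) subv_add -!memvE Pu Pv.
Qed.

End Spread.

(** * Lines of PG(8, q) fixed by sigma *)

Section FixedLines.

Variables (F : finFieldType) (L : fieldExtType F).
Variables (iota : 'rV[F]_9 -> 'rV[L]_3) (j : 'rV[L]_3 -> 'rV[F]_9).
Hypothesis iotaK : cancel iota j.
Hypothesis jK : cancel j iota.
Hypothesis iotaF : forall (a : F) (u v : 'rV[F]_9),
  iota (a *: u + v) = a%:A *: iota u + iota v.

Variables (tau : L -> L) (z : L).
Hypothesis tau1 : tau 1 = 1.
Hypothesis tauM : forall x y, tau (x * y) = tau x * tau y.
Hypothesis tau3 : forall x, tau (tau (tau x)) = x.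
Hypothesis tau_nt : tau z != z.
Hypothesis tau_alg : forall a : F, tau a%:A = a%:A.
Hypothesis tau_fix : forall x, tau x = x -> exists a : F, x = a%:A.

Variables (T : 'rV[L]_3 -> 'rV[L]_3) (N : F).
Hypothesis TD : forall u v, T (u + v) = T u + T v.
Hypothesis TZ : forall x v, T (x *: v) = tau x *: T v.
Hypothesis T3 : forall v, T (T (T v)) = N%:A *: v.
Hypothesis N_neq0 : N != 0.

Variable g : 'End('rV[F]_9).
Hypothesis T_iota : forall w, T (iota w) = iota (g w).

Variable B : pgpoint 'rV[L]_3 -> Prop.
Variable phi : pgpoint 'rV[L]_3 -> pgpoint 'rV[L]_3.
Variable sigma : pgpoint 'rV[F]_9 -> pgpoint 'rV[F]_9.
Hypothesis sigmaE : forall X : pgpoint 'rV[F]_9,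
  (sigma X : {vspace _}) = (g @: X)%VS.
Hypothesis sigma3 : forall X, sigma (sigma (sigma X)) = X.
Hypothesis sigma_Splane : forall (X : pgpoint 'rV[F]_9) (P : pgpoint 'rV[L]_3),
  (X <= Splane iota P)%VS -> (sigma X <= Splane iota (phi P))%VS.
Hypothesis B_phi : forall P, B P -> phi P = P.
Hypothesis B_eigen : forall (d : F) (u : 'rV[L]_3) (nz : u != 0),
  d ^+ 3 = N -> T u = d%:A *: u -> B (pgpt nz).

Local Notation Splane := (Splane iota).
Local Notation hull := (hull iotaK iotaF).
Local Notation mem_Splane := (mem_Splane iotaF).
Local Notation sub_Splane := (sub_Splane iotaK iotaF).
Local Notation sub_Splane_hull := (sub_Splane_hull iotaK iotaF).
Local Notation hull_unique := (hull_unique iotaK iotaF).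

Lemma g3 w : g (g (g w)) = N *: w.
Proof. by apply: (can_inj iotaK); rewrite -!T_iota T3 (iotaZ iotaF). Qed.

Lemma hull_sigma X : hull (sigma X) = phi (hull X).
Proof. exact/esym/hull_unique/sigma_Splane/sub_Splane_hull. Qed.

Lemma sigma_pgpt w (nz : w != 0) (nzg : g w != 0) : sigma (pgpt nz) = pgpt nzg.
Proof. by apply/pgpoint_inj; rewrite sigmaE /= limg_line. Qed.

Lemma g_neq0 w : w != 0 -> g w != 0.
Proof.
apply: contraNneq => gw; have /eqP := g3 w.
by rewrite gw !linear0 eq_sym scaler_eq0 (negPf N_neq0).
Qed.

Lemma T_phi v (P : pgpoint 'rV[L]_3) :
  v \in (P : {vspace _}) -> T v \in (phi P : {vspace _}).
Proof.
rewrite -[v]jK T_iota; move: (j v) => w Pw.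
have [->|nz] := eqVneq w 0; first by rewrite linear0 (iota0 iotaF) mem0v.
have := @sigma_Splane (pgpt nz) P; rewrite (sigma_pgpt nz (g_neq0 nz)) -!memvE.
by rewrite !mem_Splane; apply.
Qed.

Lemma algZA (a b : F) (v : 'rV[L]_3) : a%:A *: (b%:A *: v) = (a * b)%:A *: v.
Proof. by rewrite scalerA -scalerAl mul1r scalerA. Qed.

(** Since d^3 = N and [tau] fixes F, the map T / d is semilinear with cube 1; its fixed vectors are
    the d-eigenvectors of [T]. *)
Lemma eigen_descent (d : F) (U D : {vspace 'rV[L]_3}) : d ^+ 3 = N ->
    (forall u, u \in U -> T u \in U) -> ~~ (U <= D)%VS ->
  exists u, [/\ u \in U, u \notin D & T u = d%:A *: u].
Proof.
move=> dN UT UD.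
have nzd : d != 0 by apply: contraNneq N_neq0 => d0; rewrite -dN d0 expr0n.
have nzA : d%:A != 0 :> L by rewrite scaler_eq0 oner_eq0 orbF.
pose S v := (d^-1)%:A *: T v.
have SZ x v : S (x *: v) = tau x *: S v by rewrite /S TZ !scalerA mulrC.
have S3 v : S (S (S v)) = v.
  rewrite /S !TZ !tau_alg T3 !algZA -dN.
  by rewrite !exprS expr0 mulr1 -!mulrA mulKf // mulKf // mulVf // !scale1r.
have [u v|u Uu|u [Uu Du Su]] :=
  semilinear_descent tau1 tauM tau3 tau_nt _ SZ S3 _ UD.
- by rewrite /S TD scalerDr.
- by rewrite rpredZ ?UT.
exists u; split=> //; by rewrite -{2}Su /S algZA mulfV // !scale1r.
Qed.

Lemma phi_fixed_eigen (d : F) (P : pgpoint 'rV[L]_3) : d ^+ 3 = N -> phi P = P ->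
  exists u (nz : u != 0), P = pgpt nz /\ T u = d%:A *: u.
Proof.
move=> dN fP; have PT u : u \in (P : {vspace _}) -> T u \in (P : {vspace _}).
  by rewrite -{2}fP; apply: T_phi.
have P0 : ~~ (P <= 0)%VS.
  by rewrite subv0 -dimv_eq0; have /eqP-> : \dim P == 1%N := valP P.
have [u [Pu]] := eigen_descent dN PT P0; rewrite memv0 => nz Tu.
by exists u, nz; split=> //; apply: pgpt_mem.
Qed.

(** Together with [B_phi] this identifies the type I points with the fixed points of [phi]. *)
Lemma phi_fixed_B (d : F) (P : pgpoint 'rV[L]_3) : d ^+ 3 = N -> phi P = P -> B P.
Proof.
by move=> dN /(phi_fixed_eigen dN)[u [nz [-> Tu]]]; apply: B_eigen Tu.
Qed.

(* If g^2 w = x w + y g w, comparing with g^3 w = N w gives x = - y^2 and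
   N = x y = (- y)^3. *)
Lemma invariant_line_cube (l : {vspace 'rV[F]_9}) : pgline l ->
  (forall w, w \in l -> g w \in l) -> exists d, d ^+ 3 = N.
Proof.
move=> dl gl; have [w [_ [lw _ nz _]]] := pgline_ex dl.
have [/vlineP[c gw]|gw] := boolP (g w \in <[w]>%VS).
  exists c; have /eqP := g3 w; rewrite gw !linearZ /= gw !linearZ /= gw !scalerA.
  rewrite -subr_eq0 -scalerBl scaler_eq0 (negPf nz) orbF subr_eq0 => /eqP <-.
  by rewrite !exprS expr0 mulr1 mulrA.
have lggw := gl _ (gl _ lw).
move: lggw; rewrite (pgline_gen dl lw (gl _ lw) nz gw) => /line_vecP[x [y e]].
exists (- y).
have [] : x * y - N = 0 /\ x + y * y = 0.
  apply: (line_free nz gw); rewrite scalerBl -g3 e linearD !linearZ /= e.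
  rewrite scalerDr !scalerA scalerDl (mulrC y x) [x *: _ + (_ + _)]addrCA.
  by rewrite opprD addNKr addNr.
move=> /subr0_eq <- /eqP; rewrite addr_eq0 => /eqP->.
ring.
Qed.

Lemma mul_alg_tau_fix (d : F) (x : L) : d != 0 ->
  tau x * d%:A = d%:A * x -> exists a : F, x = a%:A.
Proof.
move=> nzd e; apply: tau_fix; apply: (@mulIf _ d%:A); last by rewrite e mulrC.
by rewrite scaler_eq0 oner_eq0 orbF.
Qed.

(** If two independent vectors of [l] became proportional over L, semilinearity would make their
    ratio fixed by [tau], hence in F, against independence over F. *)
Lemma eigen_line_notin_Splane (d : F) (l : {vspace 'rV[F]_9}) : d != 0 ->
    pgline l -> (forall w, w \in l -> g w = d *: w) ->
  forall P : pgpoint 'rV[L]_3, ~ (l <= Splane P)%VS.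
Proof.
move=> nzd dl gd P lP; have [u [v [lu lv nzu]]] := pgline_ex dl.
have nzu' : iota u != 0 by rewrite (iota_eq0 iotaK iotaF).
have := subvP lP _ lu; have := subvP lP _ lv; rewrite !mem_Splane => Pv Pu.
move: Pv; rewrite (pgpt_mem nzu' Pu) => /vlineP[x ev] /negP[].
have TdE w : w \in l -> T (iota w) = d%:A *: iota w.
  by move=> lw; rewrite T_iota gd // (iotaZ iotaF).
have [a ea] : exists a : F, x = a%:A.
  apply: (mul_alg_tau_fix nzd); have /eqP := TdE _ lv.
  rewrite ev TZ TdE // !scalerA -subr_eq0 -scalerBl scaler_eq0 (negPf nzu') orbF.
  by rewrite subr_eq0 => /eqP.
apply/vlineP; exists a; apply: (can_inj iotaK).
by rewrite (iotaZ iotaF) -ea.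
Qed.

(** Two descents give L-independent d-eigenvectors [u1], [u2] of [V]. The F-span [A] of their
    preimages is a line of PG(8, q) on which [g] is scalar, and [hull] matches its q + 1 points with
    the type I points of [V]. *)
Lemma stable_line_typeI (d : F) (V : {vspace 'rV[L]_3}) : d ^+ 3 = N ->
  pgline V -> (forall v, v \in V -> T v \in V) -> typeI_line B V.
Proof.
move=> dN dV VT; split=> //.
have nzd : d != 0 by apply: contraNneq N_neq0 => d0; rewrite -dN d0 expr0n.
have [|u1 [Vu1]] := eigen_descent (D := 0%VS) dN VT.
  by rewrite subv0 -dimv_eq0 dV.
rewrite memv0 => nz1 Tu1.
have [|u2 [Vu2 u12 Tu2]] := eigen_descent (D := <[u1]>%VS) dN VT.
  by apply/negP=> /dimvS; rewrite dV dim_vline nz1.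
have eV := pgline_gen dV Vu1 Vu2 nz1 u12.
have nzj : j u1 != 0 by rewrite -(iota_eq0 iotaK iotaF) jK.
have j12 : j u2 \notin <[j u1]>%VS.
  apply: contra u12 => /vlineP[a /(congr1 iota)]; rewrite (iotaZ iotaF) !jK => ->.
  by rewrite memvZ ?memv_line.
pose A := (<[j u1]> + <[j u2]>)%VS.
have dA : pgline A by apply: dim_addv_line.
have iotaA a b : iota (a *: j u1 + b *: j u2) = a%:A *: u1 + b%:A *: u2.
  by rewrite iotaF (iotaZ iotaF) !jK.
have TA a b : T (a%:A *: u1 + b%:A *: u2) = d%:A *: (a%:A *: u1 + b%:A *: u2).
  by rewrite TD !TZ !tau_alg Tu1 Tu2 scalerDr !algZA !(mulrC d).
have gA w : w \in A -> g w = d *: w.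
  move=> /line_vecP[a [b ->]]; apply: (can_inj iotaK).
  by rewrite -T_iota (iotaZ iotaF) iotaA TA.
apply: eq_has_card (has_card_image (f := hull) _ (pgline_card dA)); last first.
  by move=> X Y; apply: hull_inj_line dA (eigen_line_notin_Splane nzd dA gA).
move=> P; split=> [[X /line_point[w [nz [-> /line_vecP[a [b ew]]]]] <-]|[PV BP]].
  have nz' : iota w != 0 by rewrite (iota_eq0 iotaK iotaF).
  rewrite (hull_pgpt iotaK iotaF nz nz'); split.
    by rewrite -memvE ew iotaA rpredD ?rpredZ.
  by apply: (B_eigen _ dN); rewrite ew iotaA TA.
(* Conversely, a type I point of [V] is spanned by a d-eigenvector, whose coordinates with respect
   to [u1], [u2] are fixed by [tau] and so lie in F. *)
have [v [nz [eP Tv]]] := phi_fixed_eigen dN (B_phi BP).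
have /line_vecP[x [y ev]] : v \in (<[u1]> + <[u2]>)%VS by rewrite -eV memvE; move: PV; rewrite eP.
have [] : tau x * d%:A - d%:A * x = 0 /\ tau y * d%:A - d%:A * y = 0.
  apply: (line_free nz1 u12); move/eqP: Tv.
  rewrite ev TD !TZ Tu1 Tu2 scalerDr !scalerA -subr_eq0 opprD addrACA.
  by rewrite -!scalerBl => /eqP.
move=> /subr0_eq/(mul_alg_tau_fix nzd)[a ea] /subr0_eq/(mul_alg_tau_fix nzd)[b eb].
pose w := a *: j u1 + b *: j u2.
have ew : iota w = v by rewrite iotaA ev ea eb.
have nzw : w != 0 by rewrite -(iota_eq0 iotaK iotaF) ew.
exists (pgpt nzw); first by rewrite -memvE; apply/line_vecP; exists a, b.
by rewrite eP; apply/esym/hull_unique; rewrite -memvE mem_Splane ew memv_line.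
Qed.

(** * Incidences and counts on one invariant line *)

Section Line.

Variables (l : {vspace 'rV[F]_9}) (d : F).
Hypothesis dl : pgline l.
Hypothesis gl : forall w, w \in l -> g w \in l.
Hypothesis dN : d ^+ 3 = N.

Lemma sigma_line (X : pgpoint 'rV[F]_9) : (X <= l)%VS -> (sigma X <= l)%VS.
Proof.
case/line_point=> w [nz [-> lw]].
by rewrite (sigma_pgpt nz (g_neq0 nz)) -memvE gl.
Qed.

Lemma sigma_distinct3 X : sigma X <> X -> distinct3 X (sigma X) (sigma (sigma X)).
Proof.
by move=> nX; split=> e; apply: nX;
  [rewrite -e | rewrite {1}e sigma3 | rewrite e e sigma3].
Qed.

Lemma sigma_collinear3 (X : pgpoint 'rV[F]_9) :
  (X <= l)%VS -> collinear3 X (sigma X) (sigma (sigma X)).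
Proof. by move=> Xl; exists l; split=> //; do ?apply: sigma_line. Qed.

Lemma fixed_I_line_in_Splane (n : int) (P : pgpoint 'rV[L]_3) :
    has_card (fun X : pgpoint _ => (X <= l)%VS /\ sigma X = X) (n + 1) ->
    has_card (fun X : pgpoint _ => (X <= l)%VS /\ sigma X <> X) (#|F|%:Z - n) ->
    (l <= Splane P)%VS ->
  fixed_I_line iota B sigma n l.
Proof.
move=> cfix cmov lP.
(* The points of [w] and of [g w] have the same hull [P], so [phi] fixes [P]. *)
have BP : B P.
  apply: (phi_fixed_B dN); have [w [_ [lw _ nz _]]] := pgline_ex dl.
  have hP u (nzu : u != 0) : u \in l -> P = hull (pgpt nzu).
    by move=> lu; apply: hull_unique; rewrite -memvE (subvP lP).
  rewrite {1}(hP w nz lw) -hull_sigma (sigma_pgpt nz (g_neq0 nz)).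
  by rewrite -(hP _ (g_neq0 nz)) ?gl.
have SIP : SI_plane iota B (Splane P) by exists P.
split; [exact: cfix | | by exists (Splane P)].
apply: eq_has_card cmov => X; split=> [[Xl nX]|[Xl [_ [nX _ _] _]]]; last first.
  by split=> // /esym.
split=> //; split; [|exact: sigma_distinct3|exact: sigma_collinear3].
by exists (Splane P) => //; apply: subv_trans lP.
Qed.

Hypothesis nl : forall P : pgpoint 'rV[L]_3, ~ (l <= Splane P)%VS.

Let hullI X Y := @hull_inj_line F L iota j iotaK iotaF l X Y dl nl.

(** [hull] carries [sigma] to [phi] and is injective on [l], so [phi] fixes the hull exactly when
    [sigma] fixes the point. *)
Lemma hull_B (X : pgpoint 'rV[F]_9) : (X <= l)%VS -> B (hull X) <-> sigma X = X.
Proof.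
move=> Xl; split=> [/B_phi e|e].
  by apply: hullI; rewrite ?sigma_line // hull_sigma.
by apply: (phi_fixed_B dN); rewrite -hull_sigma e.
Qed.

Lemma meets_SI_iff (U : {vspace 'rV[F]_9}) :
  (SI_plane iota B U /\ meets l U) <->
  exists2 X : pgpoint 'rV[F]_9, (X <= l)%VS /\ sigma X = X & Splane (hull X) = U.
Proof.
split=> [[[P BP ->] [X [Xl XP]]]|[X [Xl fX] <-]].
  by have eP := hull_unique XP; exists X; rewrite -?eP //; split=> //;
     apply/hull_B; rewrite // -eP.
split; first by exists (hull X) => //; apply/hull_B.
by exists X; rewrite sub_Splane_hull.
Qed.

Lemma card_SI (k : int) :
    has_card (fun X : pgpoint _ => (X <= l)%VS /\ sigma X = X) k ->
  meets_exactly l (SI_plane iota B) k.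
Proof.
move=> cfix; apply: eq_has_card (fun U => iff_sym (meets_SI_iff U)) _.
apply: has_card_image cfix => X Y [Xl _] [Yl _] /(Splane_inj jK iotaF).
exact: hullI.
Qed.

(* The L-span of l, as a line of PG(2, q^3). *)
Lemma span_line : exists V : {vspace 'rV[L]_3},
  [/\ pgline V, (l <= Splane V)%VS, forall v, v \in V -> T v \in V
    & forall m, pgline m -> (l <= Splane m)%VS -> m = V].
Proof.
have [u [v [lu lv nzu uv]]] := pgline_ex dl.
have nzu' : iota u != 0 by rewrite (iota_eq0 iotaK iotaF).
have uv' : iota v \notin <[iota u]>%VS.
  apply/negP=> uv'; apply: (nl (P := pgpt nzu')).
  by rewrite (pgline_gen dl lu lv nzu uv) subv_add -!memvE !mem_Splane memv_line.
have el := pgline_gen dl lu lv nzu uv.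
pose V := (<[iota u]> + <[iota v]>)%VS.
have lV : (l <= Splane V)%VS.
  by rewrite el subv_add -!memvE !mem_Splane !memvE addvSl addvSr.
exists V; split=> //; first exact: dim_addv_line.
  have VT w : w \in l -> T (iota w) \in V.
    by move=> /gl/(subvP lV); rewrite mem_Splane T_iota.
  move=> _ /line_vecP[a [b ->]]; rewrite TD !TZ.
  by rewrite rpredD ?rpredZ ?VT.
move=> m dm lm; apply: (pgline_gen dm) => //.
  by rewrite -mem_Splane (subvP lm).
by rewrite -mem_Splane (subvP lm).
Qed.

(** The hulls of an orbit on [l] lie on the L-span of [l], hence are collinear; injectivity of
    [hull] on [l] keeps them distinct. *)
Lemma hull_typeII (X : pgpoint 'rV[F]_9) :
  (X <= l)%VS -> typeII_point phi (hull X) <-> sigma X <> X.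
Proof.
move=> Xl; split=> [[[n12 _ _] _] e|nX].
  by apply: n12; rewrite -hull_sigma e.
have [V [dV lV _ _]] := span_line.
have hV (Y : pgpoint 'rV[F]_9) : (Y <= l)%VS -> (hull Y <= V)%VS.
  by move=> Yl; rewrite -sub_Splane; apply: subv_trans lV.
have sXl := sigma_line Xl; have ssXl := sigma_line sXl.
have [n12 n13 n23] := sigma_distinct3 nX.
rewrite /typeII_point -!hull_sigma; split; last by exists V; split=> //; apply: hV.
by split=> e; [apply: n12|apply: n13|apply: n23]; apply: hullI.
Qed.

Lemma meets_SII_iff (U : {vspace 'rV[F]_9}) :
  (SII_plane iota phi U /\ meets l U) <->
  exists2 X : pgpoint 'rV[F]_9, (X <= l)%VS /\ sigma X <> X & Splane (hull X) = U.
Proof.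
split=> [[[P BP ->] [X [Xl XP]]]|[X [Xl fX] <-]].
  by have eP := hull_unique XP; exists X; rewrite -?eP //; split=> //;
     apply/hull_typeII; rewrite // -eP.
split; first by exists (hull X) => //; apply/hull_typeII.
by exists X; rewrite sub_Splane_hull.
Qed.

Lemma fixed_II_line_notin_Splane (n : int) :
    has_card (fun X : pgpoint _ => (X <= l)%VS /\ sigma X = X) (n + 1) ->
    has_card (fun X : pgpoint _ => (X <= l)%VS /\ sigma X <> X) (#|F|%:Z - n) ->
  fixed_II_line iota B phi sigma n l.
Proof.
move=> cfix cmov; split; [exact: cfix | | exact: card_SI | |].
- apply: eq_has_card cmov => X.
  split=> [[Xl nX]|[Xl [[U [P tP ->] XP] _]]]; split=> //.
    split; last exact: sigma_collinear3.
    exists (Splane (hull X)); last exact: sub_Splane_hull.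
    by exists (hull X) => //; apply/hull_typeII.
  by apply/hull_typeII; rewrite // -(hull_unique XP).
- apply: eq_has_card (fun U => iff_sym (meets_SII_iff U)) _.
  apply: has_card_image cmov => X Y [Xl _] [Yl _] /(Splane_inj jK iotaF).
  exact: hullI.
(* The L-span of [l] is [T]-stable, hence a type I line, and any L-line whose H-5-space contains [l]
   equals it. *)
have [V [dV lV VT Vuniq]] := span_line; exists (Splane V); split=> //.
  by exists V; [apply: (stable_line_typeI dN) | rewrite (H5spaceE iotaF)].
by move=> _ [m dm ->]; rewrite (H5spaceE iotaF) => /(Vuniq m dm)->.
Qed.

End Line.

Lemma ptwise_fixed_line_scalar (l : {vspace 'rV[F]_9}) (c : F) :
    pgline l -> (forall w, w \in l -> g w = c *: w) ->
  ptwise_fixed_line iota B sigma l.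
Proof.
move=> dl gc.
have gl w : w \in l -> g w \in l by move=> lw; rewrite gc ?memvZ.
have [w [_ [lw _ nzw _]]] := pgline_ex dl.
have cN : c ^+ 3 = N.
  have /eqP := g3 w; rewrite (gc (g (g w))) ?gl // (gc (g w)) ?gl // gc // !scalerA.
  rewrite -subr_eq0 -scalerBl scaler_eq0 (negPf nzw) orbF subr_eq0 => /eqP <-.
  by rewrite !exprS expr0 mulr1 mulrA.
have nzc : c != 0 by apply: contraNneq N_neq0 => c0; rewrite -cN c0 expr0n.
have nl := eigen_line_notin_Splane nzc dl gc.
have fixU (U : {vspace 'rV[F]_9}) :
    (forall x, x \in U -> g x = c *: x) -> ptwise_fixed sigma U.
  move=> gU X /line_point[x [nz [-> Ux]]].
  by rewrite (sigma_pgpt nz (g_neq0 nz)); apply: pgpt_eq; rewrite gU ?memvZ ?memv_line.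
split; first exact: fixU.
  apply: (card_SI dl gl cN nl); apply: eq_has_card (pgline_card dl) => X.
  by split=> [Xl|[]//]; split=> //; apply: fixU Xl.
have [V [dV lV _ _]] := span_line dl gl nl.
(* As L^3 has dimension 3, some eigenvector lies outside the L-span of [l]; its preimage extends [l]
   to a plane on which [g] is still the scalar [c]. *)
have [//||u [_ Vu Tu]] := @eigen_descent c fullv V cN.
  by move=> u; rewrite !memvf.
  by apply/negP=> /dimvS; rewrite dV dimvf /dim /=.
have lu : j u \notin l.
  by apply: contra Vu => /(subvP lV); rewrite mem_Splane jK.
exists (l + <[j u]>)%VS; last exact: addvSl; split.
  rewrite /pgplane dimv_disjoint_sum ?dl ?dim_vline.
    by case: eqP lu => // ->; rewrite mem0v.
  apply/eqP; rewrite -subv0; apply/subvP=> x; rewrite memv_cap memv0.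
  case/andP=> lx ux; apply: contraNT lu => nzx.
  by case/vlineP: (vline_sym nzx ux) => a ->; rewrite memvZ.
apply: fixU => _ /memv_addP[x lx [_ /vlineP[a ->] ->]].
rewrite linearD linearZ /= gc // scalerDr; congr (_ + _).
apply: (can_inj iotaK); rewrite !(iotaZ iotaF) -T_iota jK Tu.
by rewrite !algZA mulrC.
Qed.

End FixedLines.

(** * Passage from the collineation to a semilinear map, and the three cases *)

Theorem theorem2 (F : finFieldType) (L : fieldExtType F)
    (hq : (2 < #|F|)%N) (hL : \dim {: L} = 3%N)
    (n : int) (hn : n \in [:: -1; 0; 1]) (hnq : (#|F|%:Z = n %[mod 3])%Z)
    (B : pgpoint 'rV[L]_3 -> Prop) (hB : subplane B)
    (phi : pgpoint 'rV[L]_3 -> pgpoint 'rV[L]_3)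
    (hphi : collineation phi) (hphi3 : has_order 3 phi)
    (hphiB : forall P : pgpoint 'rV[L]_3, B P -> phi P = P)
    (iota : 'rV[F]_9 -> 'rV[L]_3) (hiota : identification iota)
    (sigma : pgpoint 'rV[F]_9 -> pgpoint 'rV[F]_9)
    (hsigma : projectivity sigma) (hsigma3 : has_order 3 sigma)
    (hsigmaphi : forall P : pgpoint 'rV[L]_3,
       maps_onto sigma (Splane iota P) (Splane iota (phi P)))
    (l : {vspace 'rV[F]_9}) (hl : pgline l) (hfix : maps_onto sigma l l) :
  [\/ ptwise_fixed_line iota B sigma l,
      fixed_I_line iota B sigma n l
    | fixed_II_line iota B phi sigma n l].
Proof.
case: hB => M uM BM; case: hsigma => g kg gE.
case: hiota => [[j iotaK jK] iotaF].
case: hsigma3 => _ sigma3 _; case: hphi3 => _ _ /(_ 1%N isT) phi_nt.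
(* [T] is [g] transported to L^3; on points it induces [phi]. *)
pose T v := iota (g (j v)).
have T_iota w : T (iota w) = iota (g w) by rewrite /T iotaK.
have g_eq0 w : (g w == 0) = (w == 0) by rewrite -memv_ker kg memv0.
have g_neq0 w : w != 0 -> g w != 0 by rewrite g_eq0.
have T_neq0 v : v != 0 -> T v != 0.
  by rewrite /T (iota_eq0 iotaK iotaF) g_eq0 -(iota_eq0 iotaK iotaF) jK.
have sigma_pt w (nz : w != 0) (nzg : g w != 0) : sigma (pgpt nz) = pgpt nzg.
  by apply/pgpoint_inj; rewrite gE /= limg_line.
have sigma_Splane (X : pgpoint 'rV[F]_9) (P : pgpoint 'rV[L]_3) :
    (X <= Splane iota P)%VS -> (sigma X <= Splane iota (phi P))%VS.
  by move=> XP; apply/(hsigmaphi P); exists X.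
have phiE v (nz : v != 0) : phi (pgpt nz) = pgpt (T_neq0 v nz).
  have nzj : j v != 0 by rewrite -(iota_eq0 iotaK iotaF) jK.
  apply: pgpt_mem; have := sigma_Splane (pgpt nzj) (pgpt nz).
  rewrite (sigma_pt _ nzj (g_neq0 _ nzj)) -!memvE !(mem_Splane iotaF) jK.
  by apply; apply: memv_line.
have TF a u v : T (a%:A *: u + v) = a%:A *: T u + T v.
  by rewrite -[u]jK -[v]jK -iotaF !T_iota linearP iotaF.
have T0 : T 0 = 0 by rewrite -{1}(iota0 iotaF) T_iota linear0 (iota0 iotaF).
have T_line x v : T (x *: v) \in <[T v]>%VS.
  have [->|nzx] := eqVneq x 0; first by rewrite scale0r T0 mem0v.
  have [->|nzv] := eqVneq v 0; first by rewrite scaler0 T0 mem0v.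
  have nzxv : x *: v != 0 by rewrite scaler_eq0 negb_or nzx.
  have := phiE _ nzxv; rewrite (pgpt_eq nzv nzxv) ?memvZ ?memv_line // phiE.
  by move/(congr1 (@pgpoint_vspace _ _)) => /= ->; apply: memv_line.
have T_frame (a : 'rV[F]_3) :
    T (map_mx (in_alg L) a *m M) \in <[map_mx (in_alg L) a *m M]>%VS.
  have [->|nza] := eqVneq a 0; first by rewrite map_mx0 mul0mx T0 mem0v.
  have nzv : map_mx (in_alg L) a *m M != 0.
    apply: contraNneq nza => /(congr1 (mulmx^~ (invmx M))).
    by rewrite mul0mx mulmxK // => /eqP; rewrite map_mx_eq0.
  have /hphiB : B (pgpt nzv) by apply/BM; exists a.
  by rewrite phiE => /(congr1 (@pgpoint_vspace _ _)) /= <-; apply: memv_line.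
have T_eq0 v : T v = 0 -> v = 0.
  by move=> Tv; apply/eqP/(contraTT (T_neq0 v)); rewrite Tv.
have [tau [c [nzc tau1 tauM tauF TE]]] := frame_semilinear uM TF T_eq0 T_line T_frame.
have TD u v : T (u + v) = T u + T v by have := TF 1 u v; rewrite !scale1r.
have TZ := frame_semilinearZ tauM uM TE.
(* From the order of [sigma], the cube of [g] sends each vector to an F-multiple of itself, with a
   factor that could still vary; [frame_order3] makes it constant. *)
have [|tau3 [N nzN T3]] := frame_order3 tau1 tauM tauF uM nzc TE.
  move=> v; rewrite -[v]jK !T_iota; move: (j v) => w.
  have [->|nz] := eqVneq w 0.
    by exists 0; rewrite !linear0 (iota0 iotaF) scaler0.
  have nz1 := g_neq0 _ nz; have nz2 := g_neq0 _ nz1; have nz3 := g_neq0 _ nz2.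
  have := sigma3 (pgpt nz); rewrite /= (sigma_pt _ nz nz1) (sigma_pt _ nz1 nz2).
  rewrite (sigma_pt _ nz2 nz3).
  move=> /(congr1 (@pgpoint_vspace _ _)) /= e.
  have /vlineP[a ->] : g (g (g w)) \in <[w]>%VS by rewrite -e memv_line.
  by exists a; rewrite (iotaZ iotaF).
have [[z tau_nt]|tau_id] := tau_trivial_dec tau1 tauM tauF; last first.
  (* If [tau] were trivial, [T] would be multiplication by [c] and [phi] the identity, contrary to
     its order. *)
  case: phi_nt => P; have [v [nz ->]] := pgpointP P; rewrite /= phiE.
  apply: pgpt_eq; rewrite -[in T v](mulmxKV uM v) TE memvZ //.
  rewrite (_ : map_mx tau _ = v *m invmx M) ?mulmxKV ?memv_line //.
  by apply/rowP=> i; rewrite mxE tau_id.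
have tau_fix x := tau_fixed_alg tau1 tauM tauF hL tau_nt (x := x).
have B_eigen (d : F) u (nz : u != 0) :
    d ^+ 3 = N -> T u = d%:A *: u -> B (pgpt nz).
  move=> dN Tu; apply/BM; apply: (frame_eigen tauM uM TE tau_fix _ nz Tu).
  by apply: contraNneq nzN => d0; rewrite -dN d0 expr0n.
have gl w : w \in l -> g w \in l.
  have [->|nz lw] := eqVneq w 0; first by rewrite linear0 mem0v.
  have : (sigma (pgpt nz) <= l)%VS by apply/hfix; exists (pgpt nz).
  by rewrite (sigma_pt _ nz (g_neq0 _ nz)).
have [d dN] := invariant_line_cube iotaK iotaF T3 T_iota hl gl.
have sigma_l (X : pgpoint 'rV[F]_9) : (X <= l)%VS -> (sigma X <= l)%VS.
  by move=> Xl; apply/hfix; exists X.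
have tau_algE := tau_alg tau1 tauF.
have [[s gs]|[cfix cmov]] := fixed_line_count hn hnq gE sigma3 hl sigma_l.
  apply: Or31; exact: (ptwise_fixed_line_scalar iotaK jK iotaF tau1 tauM tau3 tau_nt tau_algE
    tau_fix TD TZ T3 nzN T_iota gE sigma_Splane hphiB B_eigen hl gs).
have [u [_ [lu _ nzu _]]] := pgline_ex hl.
have nzu' : iota u != 0 by rewrite (iota_eq0 iotaK iotaF).
(* A spread element containing [l] must be the one through [u], so testing that one separates the
   two remaining cases. *)
have [lP|lP] := boolP (l <= Splane iota (pgpt nzu'))%VS.
  apply: Or32; exact: (fixed_I_line_in_Splane iotaK jK iotaF tau1 tauM tau3 tau_nt tau_algE
    TD TZ T3 nzN T_iota gE sigma3 sigma_Splane B_eigen hl gl dN cfix cmov lP).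
apply: Or33; apply: (fixed_II_line_notin_Splane iotaK jK iotaF tau1 tauM tau3 tau_nt tau_algE
  tau_fix TD TZ T3 nzN T_iota gE sigma3 sigma_Splane hphiB B_eigen hl gl dN) => //.
move=> Q lQ; case/negP: lP.
by rewrite -(@pgpt_mem _ _ _ nzu' Q) // -(mem_Splane iotaF) (subvP lQ).
Qed.
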